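(* Let $\{X_t\}$ be an irreducible, positive recurrent Markov chain on a countable state space $\Sigma$, let $i\in\Sigma$, $\epsilon,\alpha\in(0,1)$, and run $\mathrm{IteratedRefinement}(i,\epsilon,\alpha)$. With probability greater than $1-\alpha$, for all $k$, $$\hat\pi_i^{(k)}\ge\frac{\pi_i}{1+\epsilon}.$$
   Context: Chain: $\{X_t\}_{t\ge0}$ is a discrete-time Markov chain with unique stationary distribution $\pi$; $T_i=\inf\{t\ge1:X_t=i\}$. Algorithm $\mathrm{IteratedRefinement}(i,\epsilon,\alpha)$: iterations $k=1,2,\dots$ with truncation thresholds $\theta^{(k)}=2^k$ and sample sizes $N^{(1)}=\lceil 6(1+\epsilon)\ln(8/\alpha)/\epsilon^2\rceil$, $N^{(k+1)}=\lceil 3(1+\epsilon)\theta^{(k+1)}\ln(4\theta^{(k+1)}/\alpha)/(\hat T_i^{(k)}\epsilon^2)\rceil$. In iteration $k$, $N^{(k)}$ fresh independent realizations of the chain started at $X_0=i$ are simulated, each stopped at the first time $t\ge1$ with $t=\theta^{(k)}$ or $X_t=i$; the $s$-th has length $t_s$ distributed as $\min(T_i,\theta^{(k)})$. Set $\hat T_i^{(k)}=\frac1{N^{(k)}}\sum_{s=1}^{N^{(k)}}t_s$ and $\hat\pi_i^{(k)}=1/\hat T_i^{(k)}$. *)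

(* Defs.v *)
From HB Require Import structures.
From mathcomp Require Import all_boot all_order all_algebra.
From mathcomp Require Import all_classical all_reals all_analysis.

Set Implicit Arguments.
Unset Strict Implicit.
Unset Printing Implicit Defensive.

Import Order.TTheory GRing.Theory Num.Theory.
Import numFieldNormedType.Exports.

Local Open Scope classical_set_scope.
Local Open Scope ring_scope.

Section TransitionMatrix.
Context {R : realType} {Sigma : countType}.
Implicit Types (p : Sigma -> Sigma -> R) (pi : Sigma -> R).

Definition distribution_on (mu : Sigma -> R) : Prop :=
  (forall x, 0 <= mu x) /\ (\esum_(x in [set: Sigma]) (mu x)%:E = 1)%E.

Definition stochastic p : Prop := forall x, distribution_on (p x).

Definition stationary_distribution p pi : Prop :=
  distribution_on pi /\
  forall y, (\esum_(x in [set: Sigma]) ((pi x)%:E * (p x y)%:E) = (pi y)%:E)%E.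

Fixpoint nstep p (n : nat) (x y : Sigma) : \bar R :=
  if n is m.+1
  then (\esum_(z in [set: Sigma]) ((p x z)%:E * nstep p m z y))%E
  else ((x == y)%:R)%:E.

Definition irreducible p : Prop :=
  forall x y, exists n, (0 < nstep p n x y)%E.

End TransitionMatrix.

Section Chain.
Context {R : realType} {d : measure_display} {Omega : measurableType d}
  {Sigma : countType}.
Variable P : probability Omega R.
Implicit Types (p : Sigma -> Sigma -> R) (X : nat -> Omega -> Sigma).

(* The Markov property is the usual one, P(X_{n+1} = x_{n+1} | X_0 = x_0, ...,
   X_n = x_n) = p(x_n, x_{n+1}) whenever the conditioning event has positive
   probability, multiplied out.  As Sigma is countable, measurability for its
   discrete sigma-algebra is measurability of the preimages of points. *)
Definition markov_chain p (i : Sigma) X : Prop :=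
  [/\ forall t x, measurable (X t @^-1` [set x]),
      P (X 0%N @^-1` [set i]) = 1%E
    & forall (n : nat) (x : nat -> Sigma),
        P [set w | forall t, (t <= n.+1)%N -> X t w = x t] =
        (P [set w | forall t, (t <= n)%N -> X t w = x t]
         * (p (x n) (x n.+1))%:E)%E].

(* T_i = inf {t >= 1 : X_t = i}, equal to +oo if there is no such t. *)
Definition return_time (i : Sigma) X (w : Omega) : \bar R :=
  ereal_inf [set (t%:R)%:E | t in [set t : nat | (1 <= t)%N /\ X t w = i]].

Definition generated_by X : set (set Omega) :=
  <<s [set X tx.1 @^-1` [set tx.2] | tx in [set: nat * Sigma]] >>.

Definition mutually_independent {I : eqType} (F : I -> set (set Omega)) : Prop :=
  forall (J : seq I) (A : I -> set Omega), uniq J ->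
    (forall j, j \in J -> F j (A j)) ->
    P (\big[setI/setT]_(j <- J) A j) = (\prod_(j <- J) P (A j))%E.

End Chain.

(* E_x[T_x] < oo for every state x.  This depends only on p, which determines
   the law of the chain started at x; the quantification over realizations
   only avoids fixing one. *)
Definition positive_recurrent {R : realType} {Sigma : countType}
    (p : Sigma -> Sigma -> R) : Prop :=
  forall (x : Sigma) (d : measure_display) (Omega : measurableType d)
    (P : probability Omega R) (X : nat -> Omega -> Sigma),
    markov_chain P p x X -> (\int[P]_w return_time x X w < +oo)%E.

(* The algorithm as a deterministic function of its random input: y k s t is
   the state at time t of the s-th trajectory reserved for iteration k.
   Iterations are numbered from 1 and samples from 0; only the first
   sample_size k trajectories of iteration k are used, each up to its stopping
   time. *)
Section IteratedRefinement.
Context {R : realType} {Sigma : countType}.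
Variables (i : Sigma) (eps alpha : R).
Implicit Type y : nat -> nat -> nat -> Sigma.

Definition threshold (k : nat) : nat := (2 ^ k)%N.

(* First t >= 1 with t = theta or x_t = i (for theta >= 1): the position found
   in the list 1, ..., theta is counted from 0. *)
Definition stopping_time (theta : nat) (x : nat -> Sigma) : nat :=
  (find (fun t => (t == theta) || (x t == i)) (iota 1 theta)).+1.

Definition mean_time (theta N : nat) (x : nat -> nat -> Sigma) : R :=
  (N%:R)^-1 * \sum_(s < N) (stopping_time theta (x s))%:R.

Definition natceil (r : R) : nat := `|Num.ceil r|%N.

(* The value at 0 is a dummy. *)
Fixpoint sample_size y (k : nat) : nat :=
  match k with
  | 0 => 0%N
  | 1 => natceil (6 * (1 + eps) * ln (8 / alpha) / eps ^+ 2)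
  | (_.+1 as k').+1 =>
      natceil (3 * (1 + eps) * (threshold k)%:R
               * ln (4 * (threshold k)%:R / alpha)
               / (mean_time (threshold k') (sample_size y k') (y k')
                  * eps ^+ 2))
  end.

Definition T_hat y (k : nat) : R :=
  mean_time (threshold k) (sample_size y k) (y k).

Definition pi_hat y (k : nat) : R := (T_hat y k)^-1.

End IteratedRefinement.

(* Main.v *)
(* Write m = 1 / pi_i and T = T_i.  Decomposing a stationary trajectory
   according to its last visit to i before time n gives
   pi_i * sum_(t < n) P_i(T > t) <= 1, so E_i[min(T, theta)] <= m for every
   theta: only this half of Kac's formula is needed, and it requires neither
   irreducibility nor recurrence.  Conditionally on the iterations before the
   k-th one, N^(k) is fixed and the lengths are independent with values in
   [0, theta^(k)], so by Chernoff's bound the estimate T^(k) exceeds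
   (1 + eps) m with probability at most
   exp (- eps^2 m N^(k) / (3 theta^(k))).  As long as T^(k-1) <= (1 + eps) m,
   the choice of N^(k) makes this at most alpha / (4 theta^(k)).  Hence the
   first failure happens at iteration k with probability at most
   alpha / (4 * 2^k), and these bounds sum to alpha / 4 < alpha.

   The conditioning is avoided by the notion [indep_of]: an event determined by
   the iterations before the k-th one satisfies the product rule with all the
   events that prescribe finitely many lengths from iteration k on.  This
   property passes to countable disjoint unions, and the values of the lengths
   used at iteration k cut the space into countably many such events. *)

Require Import Defs.
From HB Require Import structures.
From mathcomp Require Import all_boot all_order all_algebra.
From mathcomp Require Import ring lra.
From mathcomp Require Import all_classical all_reals all_analysis.

Set Implicit Arguments.
Unset Strict Implicit.
Unset Printing Implicit Defensive.

Import Order.TTheory GRing.Theory Num.Theory.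
Import numFieldNormedType.Exports.

Local Open Scope classical_set_scope.
Local Open Scope ring_scope.

(** * Stationary distributions and avoidance of a state *)

Section Summation.
Context {R : realType}.
Local Open Scope ereal_scope.

Lemma esumZl (T : choiceType) (D : set T) (r : R) (a : T -> \bar R) :
  (0 <= r)%R -> (forall x, 0 <= a x) ->
  \esum_(x in D) (r%:E * a x) = r%:E * \esum_(x in D) a x.
Proof.
move=> r0 a0; rewrite /esum -ereal_supZl//; last first.
  by apply/set0P; exists (\sum_(x \in set0) a x), set0 => //; exact: fsets_set0.
rewrite image_comp; congr ereal_sup; apply: eq_imagel => A _ /=.
by rewrite ge0_mule_fsumr.
Qed.

Lemma exchange_esum (T1 T2 : choiceType) (A : set T1) (B : set T2)
    (a : T1 -> T2 -> \bar R) : (forall x y, 0 <= a x y) ->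
  \esum_(x in A) \esum_(y in B) a x y = \esum_(y in B) \esum_(x in A) a x y.
Proof.
move=> a0; rewrite !esum_esum//.
rewrite (@reindex_esum _ _ _ (B `*` A) (A `*` B) (fun z => (z.2, z.1)))//.
split => [[y x] [] //| [x y] [x' y'] _ _ [-> ->] //|[x y] [/= Ax By]].
by exists (y, x).
Qed.

Lemma measure_bigcup_esum d (T : measurableType d)
    (mu : {measure set T -> \bar R}) (I : countType) (D : set I)
    (F : I -> set T) :
  (forall i, D i -> measurable (F i)) -> trivIset D F ->
  measurable (\bigcup_(i in D) F i) /\
  mu (\bigcup_(i in D) F i) = \esum_(i in D) mu (F i).
Proof.
move=> mF tF.
(* The family is moved along [pickle] to one indexed by [nat], with the empty set at the integers
   that code no element of [D]. *)
pose E n := if pickle_inv n is Some i then if `[< D i >] then F i else set0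
            else set0 : set T.
have EF i : D i -> E (pickle i) = F i.
  by move=> Di; rewrite /E pickleK_inv asboolT.
have E0 n x : E n x -> exists2 i, D i & n = pickle i.
  have := @pickle_invK I n; rewrite /E; case: pickle_inv => [i /= <-|//].
  by case: asboolP => // Di _; exists i.
have mE n : measurable (E n).
  rewrite /E; case: (pickle_inv n) => [i|]; last exact: measurable0.
  by case: asboolP => [/mF//|_]; exact: measurable0.
have tE : trivIset setT E.
  move=> m n _ _ [x [Emx Enx]].
  have [i Di mi] := E0 _ _ Emx; have [j Dj nj] := E0 _ _ Enx.
  move: Emx Enx; rewrite mi nj !EF// => Fi Fj.
  by rewrite (tF i j)//; exists x.
have -> : \bigcup_(i in D) F i = \bigcup_n E n.
  apply/seteqP; split=> [x [i Di Fx]|x [n _ Enx]].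
    by exists (pickle i) => //; rewrite EF.
  by have [i Di ni] := E0 _ _ Enx; exists i => //; rewrite -EF// -ni.
split; first exact: bigcupT_measurable.
rewrite measure_semi_bigcup//; last exact: bigcupT_measurable.
rewrite nneseries_esumT//.
rewrite (_ : \esum_(i in _) _ = \esum_(n in pickle @` D) mu (E n)); last first.
  rewrite [RHS]esum_mkcond; apply: eq_esum => n _; case: ifPn => //.
  rewrite notin_setE => nD; suff -> : E n = set0 by rewrite measure0.
  by rewrite -subset0 => x /E0[i Di ni]; apply: nD; exists i.
rewrite (@reindex_esum _ _ _ D (pickle @` D) pickle).
  by apply: eq_esum => i Di; rewrite EF.
by split => // i j _ _; exact: (pcan_inj pickleK).
Qed.

Lemma esum_finType (I : finType) (D : pred I) (a : I -> \bar R) :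
  (forall i, 0 <= a i) -> \esum_(i in [set i | D i]) a i = \sum_(i | D i) a i.
Proof.
move=> a0; rewrite esum_fset//; last exact: finite_finset.
rewrite fsbig_finite//. 2: exact: finite_finset.
rewrite -[RHS]big_filter; apply: perm_big.
apply: uniq_perm => [||i]; rewrite ?fset_uniq ?filter_uniq ?index_enum_uniq//.
rewrite mem_filter mem_index_enum andbT in_fset_set; last exact: finite_finset.
by apply/idP/idP; rewrite inE.
Qed.

Lemma measure_bigcup_fin d (T : measurableType d)
    (mu : {measure set T -> \bar R}) (I : finType) (D : pred I)
    (F : I -> set T) :
  (forall i, measurable (F i)) -> trivIset setT F ->
  mu (\bigcup_(i in [set i | D i]) F i) = \sum_(i | D i) mu (F i).
Proof.
move=> mF tF; rewrite -esum_finType//.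
apply: (measure_bigcup_esum _ _ _).2 => //.
exact: sub_trivIset tF.
Qed.

End Summation.

Section Avoidance.
Context {R : realType} {Sigma : countType}.
Variables (p : Sigma -> Sigma -> R) (i : Sigma).
Hypothesis p_stochastic : stochastic p.
Local Open Scope ereal_scope.

(** The starting state is left unconstrained and only times 1 to [n] must miss [i], so [avoid t i]
    stands for the probability that the return time to [i] exceeds [t]. *)
Fixpoint avoid (n : nat) (x : Sigma) : \bar R :=
  if n is m.+1 then \esum_(y in [set~ i]) ((p x y)%:E * avoid m y) else 1.

Lemma avoid_ge0 n x : 0 <= avoid n x.
Proof.
elim: n x => [|n IH] x /=; first exact: lee01.
by apply: esum_ge0 => y _; rewrite mule_ge0// lee_fin (p_stochastic x).1.
Qed.

Lemma avoid_le1 n x : avoid n x <= 1.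
Proof.
elim: n x => [//|n IH] x /=; rewrite -(p_stochastic x).2.
rewrite [X in X <= _]esum_mkcond.
apply: le_esum => y _; case: ifPn => _; last first.
  by rewrite lee_fin (p_stochastic x).1.
by rewrite -[X in _ <= X]mule1 lee_wpmul2l// lee_fin (p_stochastic x).1.
Qed.

(* Started from [pi], the chain makes its last visit to [i] before time [n] at
   most once; analytically, [a n], the probability of avoiding [i] during
   [n] steps, decreases by [pi i * avoid n i] at each step. *)
Lemma avoid_sum_le1 (pi : Sigma -> R) (n : nat) :
  stationary_distribution p pi ->
  \sum_(t < n) ((pi i)%:E * avoid t i) <= 1.
Proof.
move=> [[pi0 pi1] piS].
pose a n := \esum_(x in [set: Sigma]) ((pi x)%:E * avoid n x).
have pia0 m x : 0 <= (pi x)%:E * avoid m x.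
  by rewrite mule_ge0 ?lee_fin ?avoid_ge0.
have a0 m : 0 <= a m by exact: esum_ge0.
have aS m : a m.+1 + (pi i)%:E * avoid m i = a m.
  (* Stationarity absorbs the first step of the walk. What remains is [a m] without its term at
     [i]. *)
  have -> : a m.+1 = \esum_(y in [set~ i]) ((pi y)%:E * avoid m y).
    have pa0 x y : 0 <= (p x y)%:E * avoid m y.
      by rewrite mule_ge0 ?avoid_ge0// lee_fin (p_stochastic x).1.
    transitivity (\esum_(x in [set: Sigma]) \esum_(y in [set~ i])
        ((pi x)%:E * ((p x y)%:E * avoid m y))).
      by apply: eq_esum => x _; rewrite esumZl.
    rewrite exchange_esum; last by move=> x y; rewrite mule_ge0 ?lee_fin.
    apply: eq_esum => y _; rewrite -piS muleC.
    have /fineK <- : avoid m y \is a fin_num.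
      by rewrite ge0_fin_numE ?avoid_ge0// (le_lt_trans (avoid_le1 _ _)) ?ltry.
    rewrite -esumZl ?fine_ge0 ?avoid_ge0//.
      by apply: eq_esum => x _; rewrite muleA muleC.
    by move=> x; rewrite mule_ge0// lee_fin// (p_stochastic x).1.
  by rewrite /a (esumID [set~ i] setT)// !setTI setCK [in RHS]esum_set1.
suff <- : \sum_(t < n) ((pi i)%:E * avoid t i) + a n = 1 by rewrite leeDl.
elim: n => [|n IH].
  by rewrite big_ord0 add0e /a -pi1; apply: eq_esum => x _; rewrite mule1.
by rewrite big_ord_recr/= -addeA [_ * _ + _]addeC aS.
Qed.

End Avoidance.

(** * Chernoff's bound *)

Section Chernoff.
Context {R : realType}.

(** The difference of the two sides vanishes at 0. Its derivative is ln (1 + y) + 1 / (1 + y) - 1,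
    which is nonnegative because ln z <= z - 1 at z = 1 / (1 + y). *)
Lemma ln1D_ge (x : R) : 0 <= x -> 2 * x <= (2 + x) * ln (1 + x).
Proof.
move=> x0; pose f (y : R) := (2 + y) * ln (1 + y) - 2 * y.
have df (y : R) : 0 <= y ->
    is_derive y 1 f (ln (1 + y) + (2 + y) / (1 + y) - 2).
  move=> y0; have y1 : 0 < 1 + y by rewrite ltr_wpDr.
  have dl : is_derive y 1 (fun z => ln (1 + z)) (1 + y)^-1.
    have dln := is_derive1_ln y1.
    have d1 : is_derive y 1 (fun z : R => 1 + z) 1.
      by rewrite -[X in is_derive _ _ _ X]add0r; apply: is_deriveD.
    rewrite -[(1 + y)^-1]mulr1.
    exact: (@is_derive1_comp _ (@ln R) (fun z : R => 1 + z)).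
  have d2 : is_derive y 1 (fun z : R => 2 + z) 1.
    by rewrite -[X in is_derive _ _ _ X]add0r; apply: is_deriveD.
  have d3 : is_derive y 1 (fun z : R => 2 * z) 2.
    rewrite -[X in is_derive _ _ _ X]mulr1.
    exact: (@is_deriveZ _ _ _ (fun z : R => z) (2 : R)).
  have := is_deriveB (is_deriveM d2 dl) d3; move/is_derive_eq; apply.
  by rewrite /GRing.scale/= mulr1 [X in X - 2]addrC.
rewrite -subr_ge0 -[leRHS]/(f x).
have <- : f 0 = 0 by rewrite /f !addr0 ln1 !mulr0 subrr.
apply: (@ger0_derive1_le_cc _ f 0 x); rewrite ?in_itv/= ?lexx ?x0//.
- by move=> y; rewrite in_itv/= => /andP[/ltW/df[]].
- move=> y; rewrite in_itv/= => /andP[/ltW y0 _]; rewrite derive1E.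
  have [_ ->] := df y y0.
  have y1 : 0 < 1 + y by rewrite ltr_wpDr.
  have /le_ln1Dx : -1 < (1 + y)^-1 - 1 by rewrite ltrBrDr addrC subrr invr_gt0.
  rewrite addrC subrK lnV// => h.
  suff : (2 + y) / (1 + y) = 1 + (1 + y)^-1 by lra.
  by field; rewrite gt_eqF.
- apply: continuous_in_subspaceT => y; rewrite inE/= in_itv/= => /andP[/df].
  by move=> [+ _] _ => /derivable1_diffP/differentiable_continuous.
Qed.

(** After multiplication by 2 + x, [ln1D_ge] bounds the left side by - x^2, and 2 + x < 3 concludes.
    This is where the 3 in the sample sizes comes from. *)
Lemma chernoff_exponent (x : R) : 0 < x < 1 ->
  x - (1 + x) * ln (1 + x) <= - (x ^+ 2 / 3).
Proof.
move=> /andP[x0 x1]; have := ln1D_ge (ltW x0).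
set l := ln _ => h.
have x2 : 0 < 2 + x by rewrite ltr_wpDr// ltW.
rewrite -(ler_pM2l x2); nra.
Qed.

(* The chord bound for the convex function [v |-> (1 + x) `^ (v / b)]. *)
Lemma expR_chord (x : R) (v b : nat) : 0 < x -> (v <= b)%N -> (0 < b)%N ->
  expR (ln (1 + x) * (v%:R / b%:R)) <= 1 + x * (v%:R / b%:R).
Proof.
move=> x0 vb b0.
have b0' : 0 < b%:R :> R by rewrite ltr0n.
have t0 : 0 <= v%:R / b%:R :> R by rewrite divr_ge0.
have t1 : v%:R / b%:R <= 1 :> R by rewrite ler_pdivrMr// mul1r ler_nat.
have := convex_expR (Itv01 t0 t1) (ln (1 + x)) 0.
rewrite !convRE/= mulr0 addr0 expR0 lnK ?posrE ?addr_gt0// /unstable.onem mulrC.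
by move=> /le_trans; apply; lra.
Qed.

(** An exponential Markov inequality, phrased as a finite sum over outcomes so that it applies as
    soon as a product rule has turned probabilities into products; [q s] is the law of the [s]-th
    sample. *)
Lemma chernoff_sum (n b : nat) (q : 'I_n -> 'I_b.+1 -> R) (m x : R) :
  (0 < b)%N -> 0 <= m -> 0 < x < 1 -> (forall s v, 0 <= q s v) ->
  (forall s, \sum_v q s v = 1) ->
  (forall s, \sum_(v < b.+1) v%:R * q s v <= m) ->
  \sum_(f : {ffun 'I_n -> 'I_b.+1} | (1 + x) * m * n%:R < \sum_s (f s)%:R)
     \prod_s q s (f s)
  <= expR (- (x ^+ 2 * m * n%:R / (3 * b%:R))).
Proof.
move=> b0 m0 x01 q0 q1 qm; have /andP[x0 x1] := x01.
have b0' : 0 < b%:R :> R by rewrite ltr0n.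
(* At this rate exp (l v) = (1 + x)^(v / b), which the chord bound controls for v <= b. *)
pose l := ln (1 + x) / b%:R.
have l0 : 0 <= l by rewrite divr_ge0// ln_ge0// lerDl ltW.
pose c := (1 + x) * m * n%:R.
have qe s : \sum_(v < b.+1) expR (l * v%:R) * q s v <= expR (x * m / b%:R).
  apply: le_trans (expR_ge1Dx _).
  apply: (@le_trans _ _ (\sum_(v < b.+1) (1 + x * (v%:R / b%:R)) * q s v)).
    apply: ler_sum => v _; rewrite ler_wpM2r//.
    by rewrite /l mulrAC -mulrA expR_chord// -ltnS.
  under eq_bigr do rewrite mulrDl mul1r.
  rewrite big_split/= q1 lerD2l.
  rewrite (_ : \sum__ _ = x / b%:R * \sum_(v < b.+1) v%:R * q s v); last first.
    by rewrite mulr_sumr; apply: eq_bigr => v _; ring.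
  by rewrite [leRHS]mulrAC ler_wpM2l// divr_ge0// ltW.
(* The indicator of the tail is at most exp (l (sum - c)), whose factors are distributed over the
   samples. *)
apply: (@le_trans _ _ (\sum_(f : {ffun 'I_n -> 'I_b.+1})
    expR (- (l * c)) * \prod_s (expR (l * (f s)%:R) * q s (f s)))).
  rewrite [leLHS]big_mkcond/=; apply: ler_sum => f _.
  have p0 : 0 <= \prod_s q s (f s) by apply: prodr_ge0.
  rewrite big_split/= -expR_sum -mulr_sumr mulrA -expRD -mulrN -mulrDr.
  case: ifPn => [cf|_]; last by rewrite mulr_ge0// expR_ge0.
  rewrite -[leLHS]mul1r ler_wpM2r// -[leLHS]expR0 ler_expR mulr_ge0//.
  by rewrite addrC subr_ge0 ltW.
rewrite -mulr_sumr.
rewrite -(bigA_distr_bigA (fun s (v : 'I_b.+1) => expR (l * v%:R) * q s v)).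
apply: (@le_trans _ _ (expR (- (l * c)) * expR (x * m / b%:R) ^+ n)).
  rewrite ler_wpM2l ?expR_ge0// -[n in leRHS]card_ord -prodr_const.
  apply: ler_prod => s _; rewrite qe andbT.
  by apply: sumr_ge0 => v _; rewrite mulr_ge0 ?expR_ge0.
rewrite -expRM_natl -expRD ler_expR /l /c.
have -> : - (ln (1 + x) / b%:R * ((1 + x) * m * n%:R)) + n%:R * (x * m / b%:R)
    = (m * n%:R / b%:R) * (x - (1 + x) * ln (1 + x)) by ring.
have -> : - (x ^+ 2 * m * n%:R / (3 * b%:R))
    = (m * n%:R / b%:R) * - (x ^+ 2 / 3) by rewrite invfM; ring.
by rewrite ler_wpM2l ?chernoff_exponent// divr_ge0// mulr_ge0.
Qed.

End Chernoff.

(** * Truncated return times *)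

Section StoppingTime.
Context {Sigma : countType} (i : Sigma).

Lemma stopping_time_le (b : nat) (x : nat -> Sigma) :
  (0 < b)%N -> (stopping_time i b x <= b)%N.
Proof.
move=> b0; rewrite /stopping_time -[X in (_ <= X)%N](size_iota 1) -has_find.
by apply/hasP; exists b; rewrite ?eqxx// mem_iota b0 add1n ltnSn.
Qed.

Lemma stopping_time_avoid (b t u : nat) (x : nat -> Sigma) :
  (t < stopping_time i b x)%N -> (t <= b)%N -> (0 < u <= t)%N -> x u != i.
Proof.
rewrite /stopping_time ltnS => tf tb /andP[u0 ut].
(* Time [u] sits at position [u.-1] of [iota 1 b]. *)
have uf : (u.-1 < find (fun t => (t == b) || (x t == i)) (iota 1 b))%N.
  by rewrite (leq_trans _ tf)// prednK.
have := before_find 0%N uf; rewrite nth_iota ?add1n ?prednK ?(leq_trans ut)//.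
by move/negbT; rewrite negb_or => /andP[].
Qed.

(** The measurable space is arbitrary, so that the lemma also applies to the sigma-algebra generated
    by a single trajectory. *)
Lemma measurable_stopping_time d (T : measurableType d) (X : nat -> T -> Sigma)
    (b v : nat) : (forall t, measurable (X t @^-1` [set i])) ->
  measurable [set w | stopping_time i b (X^~ w) = v].
Proof.
move=> mX; rewrite /stopping_time; case: v => [|v].
  by rewrite (_ : mkset _ = set0)// -subset0 => w.
rewrite (_ : mkset _ = [set w |
    find (fun t => (t == b) || (X t w == i)) (iota 1 b) = v]); last first.
  by apply/seteqP; split => w /= [->].
elim: (iota 1 b) v => [|t s IH] v /=.
  case: v => [|v]; [rewrite (_ : mkset _ = setT)|rewrite (_ : mkset _ = set0)] => //.
  - by apply/seteqP; split.
  - by apply/seteqP; split.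
have mt : measurable [set w | (t == b) || (X t w == i)].
  case: (t == b) => /=; first by rewrite (_ : mkset _ = setT)//; apply/seteqP; split.
  rewrite (_ : mkset _ = X t @^-1` [set i])//.
  by apply/seteqP; split => w /= /eqP.
case: v => [|v].
  rewrite (_ : mkset _ = [set w | (t == b) || (X t w == i)])//.
  by apply/seteqP; split => w /=; case: ifP.
rewrite (_ : mkset _ = ~` [set w | (t == b) || (X t w == i)] `&`
  [set w | find (fun t => (t == b) || (X t w == i)) s = v]).
  by apply: measurableI; [exact: measurableC|exact: IH].
apply/seteqP; split => w /=; first by case: ifP => // _ [].
by case: ifP => [_ []//|_ [_ ->]].
Qed.

End StoppingTime.

Section BoundedVariable.
Context {R : realType} d {Omega : measurableType d} (P : probability Omega R).
Variables (tau : Omega -> nat) (b : nat).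
Hypothesis m_tau : forall v, measurable [set w | tau w = v].
Hypothesis tau_le : forall w, (tau w <= b)%N.

Lemma measurable_nat_pred (D : pred nat) : measurable [set w | D (tau w)].
Proof.
rewrite (_ : mkset _ = \bigcup_(v in [set v | D v]) [set w | tau w = v]).
  by apply: bigcup_measurable => v _; exact: m_tau.
apply/seteqP; split => [w Dw|w [v /= Dv wv]]; first by exists (tau w).
by rewrite /= wv.
Qed.

Lemma prob_nat_pred_sum (D : pred nat) :
  (P [set w | D (tau w)] =
   \sum_(v < b.+1 | D v) P [set w | tau w = v])%E.
Proof.
rewrite -(measure_bigcup_fin P (fun v : 'I_b.+1 => D v))//; last first.
  by move=> u v _ _ [w [/= -> /val_inj ->]].
congr (P _); apply/seteqP; split => [w Dw|w [v /= Dv wv]].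
  by exists (Ordinal (tau_le w : (tau w < b.+1)%N)).
by rewrite /= wv.
Qed.

Lemma prob_values_sum1 : \sum_(v < b.+1) fine (P [set w | tau w = v]) = 1.
Proof.
apply: EFin_inj; rewrite -sumEFin.
under eq_bigr do rewrite fineK ?fin_num_measure//.
rewrite -(prob_nat_pred_sum predT) -(probability_setT P); congr (P _).
by apply/seteqP; split.
Qed.

(** A value [v] counts the [t < v]; the two finite sums are then exchanged. *)
Lemma expectation_tail_sum :
  \sum_(v < b.+1) v%:R * fine (P [set w | tau w = v]) =
  \sum_(t < b) fine (P [set w | (t < tau w)%N]).
Proof.
transitivity (\sum_(v < b.+1) \sum_(t < b | (t < v)%N)
    fine (P [set w | tau w = v])).
  apply: eq_bigr => v _; rewrite sumr_const mulr_natl; congr (_ *+ _).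
  rewrite -[LHS](card_ord v) -!sum1_card.
  by rewrite (big_ord_widen b (fun=> 1%N))// -ltnS.
rewrite (exchange_big_dep predT)//=; apply: eq_bigr => t _.
apply: EFin_inj; rewrite -sumEFin fineK; last first.
  by apply: fin_num_measure; exact: (measurable_nat_pred (fun v => t < v)%N).
rewrite (prob_nat_pred_sum (fun v => (t < v)%N)).
by apply: eq_bigr => v _; rewrite fineK// fin_num_measure.
Qed.

End BoundedVariable.

(** * Avoidance probabilities of the chain and the mean truncated return time *)

Section ChainAvoidance.
Context {R : realType} {Sigma : countType} d {Omega : measurableType d}.
Variables (P : probability Omega R) (p : Sigma -> Sigma -> R) (i : Sigma).
Hypothesis p_stochastic : stochastic p.
Variable X : nat -> Omega -> Sigma.
Hypothesis X_chain : markov_chain P p i X.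
Local Open Scope ereal_scope.

Let prefix n (x : nat -> Sigma) := [set w | forall t, (t <= n)%N -> X t w = x t].
Let avoids n m := [set w | forall t, (n < t <= n + m)%N -> X t w <> i].

Let measurable_prefix n x : measurable (prefix n x).
Proof.
have [mX _ _] := X_chain.
rewrite (_ : prefix n x = \bigcap_(t in `I_n.+1) X t @^-1` [set x t]).
  by apply: bigcap_measurableType => t _; exact: mX.
by apply/seteqP; split => w h t; exact: h.
Qed.

Let measurable_avoids n m : measurable (avoids n m).
Proof.
have [mX _ _] := X_chain.
rewrite (_ : avoids n m =
    \bigcap_(t in [set t | (n < t <= n + m)%N]) ~` (X t @^-1` [set i])).
  by apply: bigcap_measurableType => t _; apply: measurableC; exact: mX.
by apply/seteqP; split => w h t; exact: h.
Qed.

(** Splitting by the state at time [n.+1] lengthens the prescribed history by one state, and the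
    Markov property then factors out one transition. The induction therefore ranges over all
    histories. *)
Let prob_prefix_avoids m n x :
  P (prefix n x `&` avoids n m) <= P (prefix n x) * avoid p i m (x n).
Proof.
elim: m n x => [|m IH] n x /=.
  by rewrite mule1 measureIl.
pose x' y t := if (t <= n)%N then x t else y.
pose F y := prefix n.+1 (x' y) `&` avoids n.+1 m.
have E : prefix n x `&` avoids n m.+1 = \bigcup_(y in [set~ i]) F y.
  apply/seteqP; split => [w [pw aw]|w [y yi [pw aw]]].
    exists (X n.+1 w); first by apply: aw; rewrite ltnSn addnS ltnS leq_addr.
    split => [t|t /andP[nt tm]].
      rewrite /x' leq_eqVlt => /orP[/eqP ->|]; first by rewrite ltnn.
      by rewrite ltnS => tn; rewrite tn pw.
    by apply: aw; rewrite (ltnW nt) addnS.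
  split => [t tn|t /andP[nt tm]].
    by rewrite pw ?(leq_trans tn)// /x' tn.
  move: nt; rewrite leq_eqVlt => /orP[/eqP <-|nt].
    by rewrite pw// /x' ltnn.
  by apply: aw; rewrite nt addSn -addnS.
have mF y : [set~ i] y -> measurable (F y) by move=> _; exact: measurableI.
have tF : trivIset [set~ i] F.
  move=> y z _ _ [w [[pw _] [qw _]]].
  by have := pw n.+1 (leqnn _); rewrite (qw n.+1 (leqnn _)) /x' ltnn.
rewrite E (measure_bigcup_esum P mF tF).2.
have [_ _ X_markov] := X_chain.
have p0 x0 y0 : (0 <= p x0 y0)%R by rewrite (p_stochastic x0).1.
have prefixE y : prefix n (x' y) = prefix n x.
  by apply/seteqP; split => w h t tn; rewrite h// /x' tn.
have /fineK <- : P (prefix n x) \is a fin_num by exact: fin_num_measure.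
rewrite -esumZl ?fine_ge0//; last first.
  by move=> y; rewrite mule_ge0 ?avoid_ge0 ?lee_fin.
apply: le_esum => y _; apply: (le_trans (IH n.+1 (x' y))).
rewrite /prefix X_markov -/(prefix n _) prefixE /x' ltnn leqnn.
rewrite fineK ?fin_num_measure// ?muleA//; exact: measurable_prefix.
Qed.

Lemma prob_avoids m :
  P [set w | forall t, (0 < t <= m)%N -> X t w <> i] <= avoid p i m i.
Proof.
have [mX P0 _] := X_chain.
have := prob_prefix_avoids m 0 (fun=> i).
have -> : prefix 0 (fun=> i) = X 0%N @^-1` [set i].
  apply/seteqP; split => w /=; first by apply.
  by move=> h t; rewrite leqn0 => /eqP ->.
rewrite P0 mul1e; apply: le_trans.
have mA : measurable (avoids 0 m) := measurable_avoids 0 m.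
(* The chain starts at [i] only almost surely: the part of the event where it does not lies in a
   null set. *)
rewrite -[X in P X <= _]/(avoids 0 m) (measureDI P mA (mX 0%N i)) addeC.
rewrite setIC -[X in _ <= X]adde0 leeD2l//.
rewrite (le_trans (y := P (~` (X 0%N @^-1` [set i]))))//.
  apply: le_measure; rewrite ?inE; last by move=> w [].
    by apply: measurableD => //; exact: mX.
  by apply: measurableC; exact: mX.
by rewrite probability_setC// P0 subee.
Qed.

(** The mean is a sum of tails. For t < b, a stopping time beyond [t] keeps the chain off [i] at
    times 1 to [t], so each tail is at most [avoid p i t i] and [avoid_sum_le1] bounds their sum. *)
Lemma mean_stopping_time (pi : Sigma -> R) (b : nat) :
  stationary_distribution p pi -> (0 < pi i)%R -> (0 < b)%N ->
  (\sum_(v < b.+1) v%:R *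
     fine (P [set w | stopping_time i b (X^~ w) = v]) <= (pi i)^-1)%R.
Proof.
move=> piS pi0 b0; have [mX _ _] := X_chain.
rewrite (@expectation_tail_sum _ _ _ P _ b)//; first last.
- by move=> w; exact: stopping_time_le.
- by move=> v; apply: measurable_stopping_time => t; exact: mX.
rewrite -(ler_pM2l pi0) mulfV ?gt_eqF// -lee_fin.
apply: le_trans (avoid_sum_le1 i p_stochastic b piS).
rewrite mulr_sumr -sumEFin; apply: lee_sum => t _.
have mt : measurable [set w | (t < stopping_time i b (X^~ w))%N].
  apply: (measurable_nat_pred _ (fun v => (t < v)%N)) => v.
  by apply: measurable_stopping_time => u; exact: mX.
rewrite EFinM; apply: lee_wpmul2l; first by rewrite lee_fin ltW.
rewrite fineK ?fin_num_measure//.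
apply: le_trans (prob_avoids t); apply: le_measure; rewrite ?inE//.
  exact: (measurable_avoids 0 t).
by move=> w /= tw u ut; apply/eqP; exact: (stopping_time_avoid tw (ltnW _) ut).
Qed.

End ChainAvoidance.

(** * Samples of random size *)

Section Independence.
Context {R : realType} d {Omega : measurableType d} (P : probability Omega R).
Context {I : eqType} (tau : I -> Omega -> nat).
Hypothesis m_tau : forall j v, measurable [set w | tau j w = v].
Local Open Scope ereal_scope.

Definition fiber (b : I -> nat) (J : seq I) : set Omega :=
  \big[setI/setT]_(j <- J) [set w | tau j w = b j].

Lemma fiberP b J w : fiber b J w <-> {in J, forall j, tau j w = b j}.
Proof.
rewrite /fiber; elim: J => [|j J IH]; first by rewrite big_nil; split.
rewrite big_cons; split => [[wj /IH wJ] k|h].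
  by rewrite inE => /orP[/eqP ->|/wJ].
split; first by apply: h; rewrite mem_head.
by apply/IH => k kJ; apply: h; rewrite inE kJ orbT.
Qed.

Lemma measurable_fiber b J : measurable (fiber b J).
Proof. by apply: bigsetI_measurable => j _; exact: m_tau. Qed.

(** [K] marks the samples not yet looked at. *)
Definition indep_of (K : pred I) (A : set Omega) : Prop :=
  measurable A /\
  forall b J, uniq J -> all K J ->
    P (A `&` fiber b J) = P A * \prod_(j <- J) P [set w | tau j w = b j].

(** Looking at the samples in [J] uses them up. Prescriptions on the disjoint lists [J] and [J']
    merge into one on [J ++ J'], and the rule for [A] is applied to both [J ++ J'] and [J]. *)
Lemma indep_of_fiber K K' A b J : indep_of K A -> subpred K' K ->
  uniq J -> all K J -> all (predC K') J -> indep_of K' (A `&` fiber b J).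
Proof.
move=> [mA iA] K'K uJ KJ K'J; split.
  by apply: measurableI => //; exact: measurable_fiber.
move=> b' J' uJ' K'J'.
pose c j := if j \in J then b j else b' j.
have cJ j : j \in J -> c j = b j by rewrite /c => ->.
have cJ' j : j \in J' -> c j = b' j.
  move=> jJ'; rewrite /c ifN//; apply/negP => jJ.
  by have := allP K'J _ jJ; rewrite /= (allP K'J' _ jJ').
have fib : fiber b J `&` fiber b' J' = fiber c (J ++ J').
  rewrite /fiber big_cat/=; congr (_ `&` _); apply: eq_big_seq => j.
    by move=> /cJ ->.
  by move=> /cJ' ->.
rewrite -setIA fib !iA//; last first.
- rewrite all_cat KJ; apply/allP => j /(allP K'J') /K'K //.
- rewrite cat_uniq uJ uJ' andbT; apply/hasPn => j jJ'; apply/negP => jJ.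
  by have := allP K'J _ jJ; rewrite /= (allP K'J' _ jJ').
rewrite big_cat/= muleA; congr (_ * _ * _); apply: eq_big_seq => j.
  by move=> /cJ ->.
by move=> /cJ' ->.
Qed.

Lemma prod_fiber_fin b J :
  \prod_(j <- J) P [set w | tau j w = b j] \is a fin_num.
Proof. by apply: prode_fin_num => j _; exact: fin_num_measure. Qed.

Lemma prod_fiber_ge0 b J : 0 <= \prod_(j <- J) P [set w | tau j w = b j].
Proof. by apply: prode_ge0 => j _; exact: measure_ge0. Qed.

Lemma indep_of_bigcup (L : countType) (D : set L) K (F : L -> set Omega) :
  (forall l, D l -> indep_of K (F l)) -> trivIset D F ->
  indep_of K (\bigcup_(l in D) F l).
Proof.
move=> iF tF; have mF l : D l -> measurable (F l) by move=> /iF[].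
have [mU PU] := measure_bigcup_esum P mF tF; split => // b J uJ KJ.
have mG l : D l -> measurable (F l `&` fiber b J).
  by move=> Dl; apply: measurableI; [exact: mF|exact: measurable_fiber].
have tG : trivIset D (fun l => F l `&` fiber b J).
  by move=> l l' Dl Dl' [w [[Fl _] [Fl' _]]]; apply: tF => //; exists w.
rewrite setI_bigcupl (measure_bigcup_esum P mG tG).2 PU muleC.
rewrite -[in RHS](fineK (prod_fiber_fin b J)) -esumZl ?fine_ge0 ?prod_fiber_ge0//.
apply: eq_esum => l Dl; apply: (etrans ((iF l Dl).2 b J uJ KJ)).
rewrite muleC fineK//;
exact: prod_fiber_fin.
Qed.

Lemma indep_of_set0 K : indep_of K set0.
Proof. by split => // b J _ _; rewrite set0I measure0 mul0e. Qed.

Hypothesis tau_indep : forall b J, uniq J ->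
  P (fiber b J) = \prod_(j <- J) P [set w | tau j w = b j].

Lemma indep_of_setT K : indep_of K setT.
Proof.
split; first exact: measurableT.
by move=> b J uJ _; rewrite setTI probability_setT mul1e tau_indep.
Qed.

End Independence.

(** * Chernoff's bound for a sample of random size *)

Section Sampling.
Context {R : realType} d {Omega : measurableType d} (P : probability Omega R).
Variable tau : nat * nat -> Omega -> nat.
Hypothesis m_tau : forall j v, measurable [set w | tau j w = v].
Local Open Scope ereal_scope.

Definition sample (k n : nat) (w : Omega) : seq nat :=
  [seq tau (k, s) w | s <- iota 0 n].

Definition from_iteration (k : nat) : pred (nat * nat) := fun j => (k <= j.1)%N.

Let block (k n : nat) := [seq (k, s) | s <- iota 0 n].

Let block_uniq k n : uniq (block k n).
Proof. by rewrite map_inj_uniq ?iota_uniq// => s s' []. Qed.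

Let block_from k n : all (from_iteration k) (block k n).
Proof. by apply/allP => j /mapP[s _ ->]; rewrite /from_iteration/=. Qed.

Let block_before k n : all (predC (from_iteration k.+1)) (block k n).
Proof. by apply/allP => j /mapP[s _ ->]; rewrite /from_iteration/= ltnn. Qed.

Let fiber_block (b : nat -> nat) k n w :
  fiber tau (fun j => b j.2) (block k n) w <->
  forall s, (s < n)%N -> tau (k, s) w = b s.
Proof.
split => [/fiberP h s sn|h].
  by apply: (h (k, s)); apply: map_f; rewrite mem_iota.
by apply/fiberP => j /mapP[s + ->]; rewrite mem_iota => /h.
Qed.

(** Finite sequences of lengths are countable in number, so any condition on the sample is a
    countable disjoint union of prescriptions. *)
Lemma indep_of_sample k (N : Omega -> nat) (F : set (seq nat)) :
  (forall n, indep_of P tau (from_iteration k) [set w | N w = n]) ->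
  indep_of P tau (from_iteration k.+1) [set w | F (sample k (N w) w)].
Proof.
move=> iN.
(* The length of [l] records the sample size, which makes [G l] the event that the sample is [l]. *)
pose G l := [set w | N w = size l] `&`
  fiber tau (fun j => nth 0%N l j.2) (block k (size l)).
have GE l w : G l w <-> sample k (N w) w = l.
  split => [[/= Nw /fiber_block wl]|wl].
    apply: (@eq_from_nth _ 0%N); rewrite size_map size_iota// => s sN.
    by rewrite (nth_map 0%N) ?size_iota// nth_iota// wl// -Nw.
  have Nw : N w = size l by rewrite -wl size_map size_iota.
  split => //; apply/fiber_block => s sl.
  by rewrite -wl (nth_map 0%N) ?size_iota ?Nw// nth_iota.
rewrite (_ : mkset _ = \bigcup_(l in F) G l).
  apply: indep_of_bigcup => // [l _|l l' _ _ [w [/GE <- /GE]]//].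
  apply: (indep_of_fiber m_tau _ (iN (size l))) => //.
  by move=> j; rewrite /from_iteration => /ltnW.
apply/seteqP; split => [w Fw|w [l Fl /GE wl]]; last by rewrite /= wl.
by exists (sample k (N w) w) => //; exact/GE.
Qed.

Variables (k b : nat) (m x : R).
Hypotheses (b0 : (0 < b)%N) (m0 : (0 <= m)%R) (x01 : (0 < x < 1)%R).
Hypothesis tau_le : forall s w, (tau (k, s) w <= b)%N.
Hypothesis tau_mean : forall s,
  (\sum_(v < b.+1) v%:R * fine (P [set w | tau (k, s) w = v]) <= m)%R.

Let exceeds n :=
  [set w | ((1 + x) * m * n%:R < \sum_(v <- sample k n w) v%:R)%R].

Lemma sample_tail n A : indep_of P tau (from_iteration k) A ->
  measurable (A `&` exceeds n) /\
  P (A `&` exceeds n) <=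
    P A * (expR (- (x ^+ 2 * m * n%:R / (3 * b%:R))))%:E.
Proof.
move=> iA; have [mA PA] := iA.
pose D (f : {ffun 'I_n -> 'I_b.+1}) :=
  ((1 + x) * m * n%:R < \sum_s (f s)%:R)%R.
(* The default 0 is never read: [block k n] contains only indices below [n]. *)
pose c (f : {ffun 'I_n -> 'I_b.+1}) (s : nat) : nat :=
  oapp (fun s : 'I_n => f s : nat) 0%N (insub s).
pose G f := A `&` fiber tau (fun j => c f j.2) (block k n).
have cE f (s : 'I_n) : c f s = f s by rewrite /c valK.
have mG f : measurable (G f).
  by apply: measurableI => //; exact: measurable_fiber.
have tG : trivIset setT G.
  move=> f g _ _ [w [[_ /fiber_block wf] [_ /fiber_block wg]]].
  by apply/ffunP => s; apply: val_inj; rewrite /= -!cE -wf// wg.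
have AE : A `&` exceeds n = \bigcup_(f in [set f | D f]) G f.
  have sumE w : (\sum_(v <- sample k n w) v%:R =
      \sum_(s < n) (tau (k, val s) w)%:R :> R)%R.
    by rewrite /sample big_map -[n in iota 0 n]subn0 big_mkord.
  apply/seteqP; split => [w [Aw]|w [f Df [Aw /fiber_block wf]]].
    rewrite /exceeds/= sumE => Dw.
    exists [ffun s : 'I_n => inord (tau (k, val s) w)].
      rewrite /= /D; under eq_bigr do rewrite ffunE inordK ?ltnS ?tau_le//.
      exact: Dw.
    split => //; apply/fiber_block => s sn.
    by rewrite (cE _ (Ordinal sn)) ffunE inordK// ltnS.
  split => //; rewrite /exceeds/= sumE.
  rewrite (eq_bigr (fun s => (f s)%:R)) => [//|s _].
  by rewrite wf ?ltn_ord//= cE.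
split.
  rewrite AE; apply: (measure_bigcup_esum P _ _).1 => //.
  exact: sub_trivIset tG.
rewrite AE measure_bigcup_fin//.
pose q (s : 'I_n) (v : 'I_b.+1) := fine (P [set w | tau (k, val s) w = v]).
have GE f : P (G f) = P A * (\prod_s q s (f s))%:E.
  rewrite /G PA// -prodEFin big_map -[n in iota 0 n]subn0 big_mkord.
  congr (_ * _).
  by apply: eq_bigr => s _; rewrite cE fineK// fin_num_measure.
rewrite (eq_bigr _ (fun f _ => GE f)).
rewrite -ge0_sume_distrr; last first.
  by move=> f _; rewrite lee_fin prodr_ge0// => s _; rewrite fine_ge0.
rewrite lee_wpmul2l// sumEFin lee_fin; apply: chernoff_sum => //.
- by move=> s v; rewrite fine_ge0.
- by move=> s; apply: prob_values_sum1.
- by move=> s; exact: tau_mean.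
Qed.

(** On each piece where [N] is constant [sample_tail] applies. The bound [delta] is common to all
    pieces, whose probabilities add up to at most 1. *)
Lemma random_sample_tail (G : set Omega) (N : Omega -> nat) (delta : R) :
  (0 <= delta)%R ->
  (forall n, indep_of P tau (from_iteration k) (G `&` [set w | N w = n])) ->
  (forall w, G w ->
     expR (- (x ^+ 2 * m * (N w)%:R / (3 * b%:R))) <= delta)%R ->
  measurable (G `&` [set w | exceeds (N w) w]) /\
  P (G `&` [set w | exceeds (N w) w]) <= delta%:E.
Proof.
move=> d0 iN Nd; pose A n := G `&` [set w | N w = n].
have tA : trivIset setT A by move=> n n' _ _ [w [[_ /= <-] [_ /= <-]]].
have mA n : setT n -> measurable (A n) by move=> _; exact: (iN n).1.
have -> : G `&` [set w | exceeds (N w) w] = \bigcup_n (A n `&` exceeds n).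
  apply/seteqP; split => [w [Gw ew]|w [n _ [[Gw /= Nw] ew]]].
    by exists (N w).
  by split => //=; rewrite Nw.
have mE n : setT n -> measurable (A n `&` exceeds n).
  by move=> _; exact: (sample_tail n (iN n)).1.
have tE : trivIset setT (fun n => A n `&` exceeds n).
  by move=> n n' _ _ [w [[An _] [An' _]]]; apply: tA => //; exists w.
have [mU ->] := measure_bigcup_esum P mE tE; split => //.
have [mUA PUA] := measure_bigcup_esum P mA tA.
apply: (@le_trans _ _ (\esum_(n in [set: nat]) (delta%:E * P (A n)))).
  (* The bound for size [n] is read off at a point of the piece; an empty piece has probability
     0. *)
  apply: le_esum => n _; have [An0|] := pselect (A n = set0).
    by rewrite An0 set0I !measure0 mule0.
  move=> /eqP/set0P[w [Gw /= Nw]].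
  apply: (le_trans (sample_tail n (iN n)).2).
  by rewrite muleC lee_wpmul2r// lee_fin -Nw Nd.
rewrite esumZl// -PUA -[X in _ <= X]mule1 lee_wpmul2l ?lee_fin//.
exact: probability_le1.
Qed.

End Sampling.

(** * The refinement iterations *)

Section SampleSizes.
Context {R : realType} {Sigma : countType}.
Variables (i : Sigma) (eps alpha : R) (y : nat -> nat -> nat -> Sigma).
Hypotheses (eps01 : 0 < eps < 1) (alpha01 : 0 < alpha < 1).

Let N := sample_size i eps alpha y.
Let T := T_hat i eps alpha y.

Lemma natceil_ge (r : R) : r <= (natceil r)%:R.
Proof. by rewrite /natceil natr_absz (le_trans (ceil_ge r))// ler_int ler_norm. Qed.

Lemma natceil_gt0 (r : R) : 0 < r -> (0 < natceil r)%N.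
Proof. by move=> r0; rewrite -(ltr0n R) (lt_le_trans r0)// natceil_ge. Qed.

Lemma threshold_gt0 k : (0 < threshold k)%N.
Proof. by rewrite expn_gt0. Qed.

Lemma ln_threshold_gt0 k : 0 < ln (4 * (threshold k)%:R / alpha).
Proof.
have /andP[a0 a1] := alpha01.
rewrite ln_gt0// ltr_pdivlMr// mul1r (lt_le_trans a1)//.
by rewrite -natrM ler1n muln_gt0 threshold_gt0.
Qed.

Lemma T_hat_ge1 k : (0 < N k)%N -> 1 <= T k.
Proof.
move=> N0; rewrite /T /T_hat /mean_time -/(N k) mulrC ler_pdivlMr ?ltr0n// mul1r.
rewrite -[n in n%:R <= _]card_ord -sumr_const; apply: ler_sum => s _.
by rewrite ler1n.
Qed.

Lemma sample_size_gt0 k : (0 < N k.+1)%N.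
Proof.
have /andP[e0 e1] := eps01; have /andP[a0 a1] := alpha01.
(* The next size divides by the current estimate, which is positive only if the current sample is
   nonempty. *)
elim: k => [|k IH]; apply: natceil_gt0.
  rewrite divr_gt0 ?exprn_gt0// !mulr_gt0 ?addr_gt0//.
  by rewrite ln_gt0// ltr_pdivlMr// mul1r (lt_trans a1)// ltr1n.
have T0 := lt_le_trans ltr01 (T_hat_ge1 IH).
rewrite divr_gt0//.
  by rewrite !mulr_gt0 ?addr_gt0 ?ltr0n ?threshold_gt0 ?ln_threshold_gt0.
by rewrite mulr_gt0 ?exprn_gt0//.
Qed.

(* [N^(1)] is the formula for [N^(k+1)] at [k = 0] with the estimate [T^(0)]
   replaced by 1, which is at most [m]: hence no hypothesis for [k = 0]. *)
Lemma sample_size_tail_le (m : R) k : 1 <= m ->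
  (k != 0%N -> T k <= (1 + eps) * m) ->
  expR (- (eps ^+ 2 * m * (N k.+1)%:R / (3 * (threshold k.+1)%:R)))
  <= alpha / (4 * (threshold k.+1)%:R).
Proof.
move=> m1 Tm.
have /andP[e0 e1] := eps01; have /andP[a0 a1] := alpha01.
set b : R := (threshold k.+1)%:R.
have b0 : 0 < b by rewrite ltr0n threshold_gt0.
set L := ln (4 * b / alpha).
have L0 : 0 < L := ln_threshold_gt0 k.+1.
have m0 : 0 < m := lt_le_trans ltr01 m1.
have e2 : 0 < eps ^+ 2 by rewrite exprn_gt0.
(* The target is exp (- L), so comparing exponents gives this lower bound on the sample size. *)
suff NL : 3 * b * L / (m * eps ^+ 2) <= (N k.+1)%:R.
  have -> : alpha / (4 * b) = expR (- L).
    by rewrite expRN lnK ?posrE ?divr_gt0 ?mulr_gt0// invf_div.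
  rewrite ler_expR lerN2 ler_pdivlMr ?mulr_gt0//.
  rewrite [leRHS]mulrC -ler_pdivrMr ?mulr_gt0//.
  by apply: le_trans NL; rewrite [_ * m]mulrC [L * _]mulrC.
(* The factor 1 + eps in the sample size compensates for an estimate [t] that exceeds [m] by up to
   that factor. *)
have ratio (t : R) : 0 < t -> t <= (1 + eps) * m ->
    3 * b * L / (m * eps ^+ 2) <= 3 * (1 + eps) * b * L / (t * eps ^+ 2).
  move=> t0 tm; rewrite !(invfM _ (eps ^+ 2)).
  rewrite (_ : 3 * (1 + eps) * b * L * (t^-1 * (eps ^+ 2)^-1) =
    3 * b * L * ((1 + eps) / t * (eps ^+ 2)^-1)); last by ring.
  rewrite ler_wpM2l ?mulr_ge0 ?(ltW L0) ?(ltW b0)//.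
  rewrite ler_wpM2r ?invr_ge0 ?(ltW e2)//.
  by rewrite ler_pdivlMr// mulrC ler_pdivrMr.
case: k Tm @b @L b0 L0 ratio => [_|k Tm] b L b0 L0 ratio;
    apply: le_trans (natceil_ge _).
  (* The first threshold is 2, whence 6 = 3 * 2 and 8 = 4 * 2. *)
  rewrite [leRHS](_ : _ = 3 * (1 + eps) * b * L / (1 * eps ^+ 2)).
    by apply: ratio; rewrite ?mulr_ege1// lerDl ltW.
  rewrite mul1r /L /b /threshold expn1 (_ : 4 * 2 = 8 :> R); last by ring.
  by congr (_ * _ / _); ring.
apply: ratio; last exact: Tm.
exact: lt_le_trans ltr01 (T_hat_ge1 (sample_size_gt0 k)).
Qed.

End SampleSizes.

(** * Failure probabilities of the iterations and their sum *)

Section Failure.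
Context {R : realType} {Sigma : countType}.
Variables (p : Sigma -> Sigma -> R) (pi : Sigma -> R).
Variables (i : Sigma) (eps alpha : R).
Hypotheses (eps01 : 0 < eps < 1) (alpha01 : 0 < alpha < 1).
Hypotheses (p_stochastic : stochastic p)
  (pi_stationary : stationary_distribution p pi) (pi_gt0 : 0 < pi i).
Context d (Omega : measurableType d) (P : probability Omega R).
Variable X : nat -> nat -> nat -> Omega -> Sigma.
Hypothesis X_chain : forall k s, markov_chain P p i (X k s).
Hypothesis X_independent :
  mutually_independent P (fun ks : nat * nat => generated_by (X ks.1 ks.2)).

Let y w k s t := X k s t w.
Let N k w := sample_size i eps alpha (y w) k.
Let T k w := T_hat i eps alpha (y w) k.
Let m := (pi i)^-1.

Let tau (j : nat * nat) w :=
  stopping_time i (threshold j.1) ((X j.1 j.2)^~ w).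

Let m_tau j v : measurable [set w | tau j w = v].
Proof.
apply: measurable_stopping_time => t; have [mX _ _] := X_chain j.1 j.2.
exact: mX.
Qed.

(** Each length is measurable for the sigma-algebra generated by its own trajectory. *)
Let tau_indep (b : nat * nat -> nat) (J : seq (nat * nat)) : uniq J ->
  P (fiber tau b J) = (\prod_(j <- J) P [set w | tau j w = b j])%E.
Proof.
move=> uJ; apply: X_independent => // j _.
apply: (@measurable_stopping_time _ i _ (g_sigma_algebraType
  [set X j.1 j.2 tx.1 @^-1` [set tx.2] | tx in [set: nat * Sigma]])) => t.
by apply: sub_sigma_algebra; exists (t, i).
Qed.

Let mean (l : seq nat) : R := (size l)%:R^-1 * \sum_(v <- l) v%:R.

Let T_mean k w : T k w = mean (sample tau k (N k w) w).
Proof.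
rewrite /T /T_hat /mean_time /mean /sample size_map size_iota big_map.
by rewrite -[n in iota 0 n]subn0 big_mkord.
Qed.

Let next k (t : R) := natceil (3 * (1 + eps) * (threshold k)%:R
  * ln (4 * (threshold k)%:R / alpha) / (t * eps ^+ 2)).

Let sample_sizeS k w : N k.+2 w = next k.+2 (T k.+1 w).
Proof. by []. Qed.

(** The guard makes the dummy iteration 0 good. *)
Let good k w := k != 0%N -> T k w <= (1 + eps) * m.

Let indep_sample_size k n :
  indep_of P tau (from_iteration k.+1) [set w | N k.+1 w = n].
Proof.
elim: k n => [n|k IH n].
  (* The first sample size is deterministic, so the event is everything or nothing. *)
  have [Nn|Nn] := eqVneq (natceil (6 * (1 + eps) * ln (8 / alpha) / eps ^+ 2)) n.
    rewrite (_ : mkset _ = setT); last by apply/seteqP; split.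
    exact: indep_of_setT.
  rewrite (_ : mkset _ = set0); first exact: indep_of_set0.
  by rewrite -subset0 => w /eqP; rewrite (negbTE Nn).
have := indep_of_sample m_tau [set l | next k.+2 (mean l) = n] IH.
rewrite (_ : mkset _ = [set w | N k.+2 w = n])//.
by apply/seteqP; split => w; rewrite /= sample_sizeS T_mean.
Qed.

(** For positive [k] both events are conditions on the mean of the sample of iteration [k]. *)
Let indep_good k n :
  indep_of P tau (from_iteration k.+1)
    ([set w | good k w] `&` [set w | N k.+1 w = n]).
Proof.
case: k => [|k].
  rewrite (_ : [set w | good 0 w] = setT) ?setTI//.
  by apply/seteqP; split.
have := indep_of_sample m_tau
  [set l | mean l <= (1 + eps) * m /\ next k.+2 (mean l) = n]
  (indep_sample_size k).
rewrite (_ : mkset _ = [set w | good k.+1 w] `&` [set w | N k.+2 w = n])//.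
apply/seteqP; split => w; rewrite /= /good sample_sizeS T_mean => -[] //.
by move=> /(_ isT).
Qed.

Let pi_le1 : pi i <= 1.
Proof.
have := avoid_sum_le1 i p_stochastic 1 pi_stationary.
by rewrite big_ord1 mule1 lee_fin.
Qed.

(** Only the iteration just before is required to be good, since it alone determines the next sample
    size. *)
Let failure k := [set w | good k w] `&` [set w | (1 + eps) * m < T k.+1 w].

Let prob_failure k : measurable (failure k) /\
  (P (failure k) <= (alpha / (4 * (threshold k.+1)%:R))%:E)%E.
Proof.
have /andP[a0 a1] := alpha01.
have m1 : 1 <= m by rewrite invf_ge1.
have m0 : 0 <= m := le_trans ler01 m1.
have [|||||mF PF] := @random_sample_tail _ _ _ P tau m_tau k.+1
  (threshold k.+1) m eps (threshold_gt0 _) m0 eps01 _ _ [set w | good k w]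
  (N k.+1) (alpha / (4 * (threshold k.+1)%:R)).
- by move=> s w; apply: stopping_time_le; exact: threshold_gt0.
- move=> s; apply: (mean_stopping_time p_stochastic (X_chain _ _)) => //.
  exact: threshold_gt0.
- by rewrite divr_ge0 ?mulr_ge0// ltW.
- by move=> n; exact: indep_good.
- by move=> w gw; exact: sample_size_tail_le.
suff <- : [set w | good k w] `&` [set w | (1 + eps) * m * (N k.+1 w)%:R <
    \sum_(v <- sample tau k.+1 (N k.+1 w) w) v%:R] = failure k by [].
congr (_ `&` _); apply/seteqP; split => w /=;
  by rewrite T_mean /mean size_map size_iota [_ * \sum_(_ <- _) _]mulrC
    ltr_pdivlMr ?ltr0n ?sample_size_gt0.
Qed.

Lemma prob_all_estimates_good :
  ((1 - alpha)%:E < P [set w | forall k, (1 <= k)%N ->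
     (pi i / (1 + eps) <= pi_hat i eps alpha (y w) k)%R])%E.
Proof.
have /andP[e0 e1] := eps01; have /andP[a0 a1] := alpha01.
have goodE k w : (0 < k)%N ->
    (pi i / (1 + eps) <= pi_hat i eps alpha (y w) k) = (T k w <= (1 + eps) * m).
  case: k => // k _; have T0 : 0 < T k.+1 w.
    by rewrite (lt_le_trans ltr01)// T_hat_ge1// sample_size_gt0.
  rewrite /pi_hat -/(y w) -/(T k.+1 w).
  by rewrite -lef_pV2 ?posrE ?invr_gt0 ?divr_gt0 ?addr_gt0// invrK invf_div.
set A := [set w | _].
have -> : A = ~` \bigcup_k failure k.
  apply/seteqP; split => [w Aw [k _ [_ /=]]|w nF k k0].
    by rewrite ltNge -goodE// Aw.
  rewrite goodE// leNgt; apply/negP => Tk; apply: nF.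
  (* At the least index with too large an estimate, the preceding iteration is good by
     minimality. *)
  have ex : exists n, (0 < n)%N && ((1 + eps) * m < T n w).
    by exists k; rewrite k0.
  case: (ex_minnP ex) => -[//|n] /= Tn nmin; exists n => //; split => //= n0.
  rewrite leNgt; apply/negP => Tn'.
  by have := nmin n; rewrite lt0n n0 Tn' ltnn => /(_ isT).
have mF k : measurable (failure k) := (prob_failure k).1.
have mU : measurable (\bigcup_k failure k) by exact: bigcupT_measurable.
have PU : (P (\bigcup_k failure k) <= (alpha / 4)%:E)%E.
  apply: (le_trans (measure_sigma_subadditive P mF mU _)) => //.
  (* The thresholds are powers of 2, so the bounds form a geometric series of sum alpha / 4. *)
  apply: (@le_trans _ _ (\sum_(0 <= k <oo) ((alpha / 4) / (2 ^ (k + 1))%:R)%:E)%E).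
    apply: lee_nneseries => // k _; rewrite (le_trans (prob_failure k).2)//.
    by rewrite lee_fin /threshold addn1 invfM mulrA.
  have /cvg_lim h := @cvg_geometric_eseries_half R (alpha / 4) 0.
  by rewrite h// expr0 divr1.
rewrite probability_setC// (@lt_le_trans _ _ (1 - (alpha / 4)%:E)%E)//.
  by rewrite -EFinB lte_fin; lra.
by rewrite leeB.
Qed.

End Failure.

Theorem theorem6 (R : realType) (Sigma : countType)
  (p : Sigma -> Sigma -> R) (pi : Sigma -> R)
  (p_stochastic : stochastic p)
  (p_irreducible : irreducible p)
  (p_recurrent : positive_recurrent p)
  (pi_stationary : unique (stationary_distribution p) pi)
  (i : Sigma) (eps alpha : R)
  (eps01 : 0 < eps < 1) (alpha01 : 0 < alpha < 1)
  (d : measure_display) (Omega : measurableType d) (P : probability Omega R)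
  (X : nat -> nat -> nat -> Omega -> Sigma)
  (X_chain : forall k s, markov_chain P p i (X k s))
  (X_independent :
     mutually_independent P (fun ks : nat * nat => generated_by (X ks.1 ks.2))) :
  ((1 - alpha)%:E <
   P [set w | forall k, (1 <= k)%N ->
        (pi i / (1 + eps) <=
        pi_hat i eps alpha (fun k s t => X k s t w) k)%R])%E.
Proof.
have [piS _] := pi_stationary.
(* If [pi i <= 0], the lower bound is nonpositive while every estimate is nonnegative, so the event
   is the whole space. *)
have [pi0|pi_le0] := ltP 0 (pi i).
  exact: (prob_all_estimates_good eps01 alpha01 p_stochastic piS).
have /andP[e0 _] := eps01; have /andP[a0 _] := alpha01.
rewrite (_ : mkset _ = setT).
  by rewrite probability_setT lte_fin ltrBlDr ltrDl.
apply/seteqP; split => // w _ k k1; rewrite (@le_trans _ _ 0)//.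
  by rewrite pmulr_lle0// invr_gt0 addr_gt0.
have -> : k = k.-1.+1 by rewrite prednK.
rewrite /pi_hat invr_ge0 (le_trans ler01)// T_hat_ge1// sample_size_gt0//.
Qed.
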